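(* Suppose that $g\notin\mathrm{Span}\{1,t_1^N,\dots,t^N_{\tilde L^N}\}$ and that $P^N\in\mathcal M^{np,N}$ is nondegenerate. Then there exists a neighborhood $\mathcal V$ of $P^N$ in $\mathcal M^{np,N}$ such that for every $P\in\mathcal V$, $\mathrm{Dual}(P)$ has a unique minimizer $(\lambda(P),\nu(P))$, $$\tilde\Psi^{+,N}(P)-\tilde\Psi^{+,N}(P^N)=\lambda(P)^\top\{b^N(P)-b^N(P^N)\},$$ and moreover $\lambda(P)=\lambda(P^N)$.
   Context: Write $[m]=\{1,\dots,m\}$. Let $J,T\ge 1$ be integers and $\mathcal A_T=\{A_1\times\cdots\times A_T: \varnothing\neq A_t\subseteq[J]\}$. For an integer $N\ge1$ fix a design $a_1^N,\dots,a_N^N\in\mathcal A_T$, let $\mathcal Y^N=a_1^N\times\cdots\times a_N^N$ and let $\mathcal M^{np,N}$ be the set of all probability measures on the finite set $\mathcal Y^N$. Let $(\mathcal B,\mathscr B)$ be a measurable space and $\mathcal Q_\beta$ the set of all probability measures on it. A choice kernel is a measurable map $s:\mathcal B\times\mathcal A_T\times[J]^T\to[0,1]$ (discrete $\sigma$-algebras on the finite factors) with $s(\beta,a,y)=0$ if $y\notin a$ and $\sum_{y\in a}s(\beta,a,y)=1$ for all $(\beta,a)$; fix one. Let $g:\mathcal B\to[0,1]$ be measurable. Let $\mathcal D^N=\{(a,y):a\in\{a_1^N,\dots,a_N^N\},y\in a\}$, $n_a=\#\{i\in[N]:a_i^N=a\}$, and for $P\in\mathcal M^{np,N}$ let $Q^{np,N}_{Y\mid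 a}(P)(a,y)=\frac1{n_a}\sum_{i:a_i^N=a}P_i(y)$ where $P_i$ is the $i$-th marginal of $P$. Let $L^N=\#\mathcal D^N$, let $(a(l),y(l))_{l\in[L^N]}$ be an ordering of $\mathcal D^N$, $t_l^N(\beta)=s(\beta,a(l),y(l))$. Let $\tilde L^N+1$ be the maximal cardinality of a linearly independent subset of the functions $\{1,t_1^N,\dots,t^N_{L^N}\}$ on $\mathcal B$, with the ordering chosen so that $1,t_1^N,\dots,t^N_{\tilde L^N}$ is such a subset. Put $t^N=(t_1^N,\dots,t^N_{\tilde L^N})^\top$ and $b^N(P)=(Q^{np,N}_{Y\mid a}(P)(a(l),y(l)))_{l=1}^{\tilde L^N}\in\mathbb R^{\tilde L^N}$. $\mathrm{Primal}(P)$: $\sup_{Q_\beta\in\mathcal Q_\beta}\int g\,dQ_\beta$ subject to $\int t_l^N\,dQ_\beta=b_l^N(P)$ for all $l\in[\tilde L^N]$; its value is denoted $\tilde\Psi^{+,N}(P)$. $\mathrm{Dual}(P)$: $\inf_{\lambda\in\mathbb R^{\tilde L^N},\nu\in\mathbb R}\lambda^\top b^N(P)+\nu$ subject to $\lambda^\top t^N(\beta)+\nu\ge g(\beta)$ for all $\beta\in\mathcal B$. Nondegeneracy: $P$ is nondegenerate if $\mathrm{Primal}(P)$ admits a maximizer of the form $Q=\sum_{l=1}^{\tilde L^N+1}Q_l\delta_{\beta_l}$ with all $Q_l>0$, $\sum_lQ_l=1$, $\beta_1,\dots,\beta_{\tilde L^N+1}\in\mathcal B$, such that the $(\tilde L^N+1)\times(\tilde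 L^N+1)$ matrix whose $l$-th row, $l\le\tilde L^N$, is $(t_l^N(\beta_k))_{k=1}^{\tilde L^N+1}$ and whose last row is $(1,\dots,1)$ has full rank. Neighborhood: $\mathcal V\subset\mathcal M^{np,N}$ is a neighborhood of $P^N$ if there is a neighborhood $v$ of $b^N(P^N)$ in $\mathbb R^{\tilde L^N}$ such that every $\bar P\in\mathcal M^{np,N}$ with $b^N(\bar P)\in v$ belongs to $\mathcal V$. *)

(* Defs.v *)
From HB Require Import structures.
From mathcomp Require Import all_boot all_order all_algebra.
From mathcomp Require Import all_classical all_reals all_analysis.

Set Implicit Arguments.
Unset Strict Implicit.
Unset Printing Implicit Defensive.

Import Order.TTheory GRing.Theory Num.Theory.
Import numFieldNormedType.Exports.

Local Open Scope classical_set_scope.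
Local Open Scope ring_scope.

(* X with the discrete sigma-algebra. *)
Definition discrete (X : Type) : Type := X.

Section Discrete.
Variable X : pointedType.

HB.instance Definition _ := Pointed.on (discrete X).
HB.instance Definition _ := @isMeasurable.Build default_measure_display
  (discrete X) (@discrete_measurable X) (@discrete_measurable0 X)
  (@discrete_measurableC X) (@discrete_measurableU X).

End Discrete.

(* There are J + 1 alternatives, T + 1 periods and (below) N + 1 observations,
   so that these numbers are >= 1.  A history is an element of [J + 1]^(T + 1),
   and a menu is a set of histories of the form A_1 x A_2 x ... with all the
   A_t nonempty. *)
Section Menus.
Variables J T : nat.

Definition history := {ffun 'I_T.+1 -> 'I_J.+1}.

HB.instance Definition _ := Finite.on history.
HB.instance Definition _ := isPointed.Build history [ffun=> ord0].

Definition menus : {set {set history}} :=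
  [set [set y : history | [forall t, y t \in A t]] |
     A : {ffun 'I_T.+1 -> {set 'I_J.+1}} & [forall t, A t != finset.set0]]%SET.

Definition menu := {a : {set history} | a \in menus}.

HB.instance Definition _ := SubFinite.on menu.

Fact full_menu_subproof : finset.setT \in menus.
Proof.
apply/imsetP; exists [ffun=> finset.setT].
  rewrite inE; apply/forallP => t; rewrite ffunE; apply/set0Pn.
  by exists ord0; rewrite inE.
by apply/setP => y; rewrite !inE; apply/esym/forallP => t /=; rewrite ffunE inE.
Qed.

HB.instance Definition _ := isPointed.Build menu
  (exist (fun a => a \in menus) _ full_menu_subproof).

Lemma menu_neq0 (a : menu) : val a != finset.set0.
Proof.
case: a => a /= /imsetP[A]; rewrite inE => /forallP A0 ->.
apply/set0Pn; exists [ffun t => xchoose (set0Pn _ (A0 t))].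
rewrite inE; apply/forallP => t /=; rewrite ffunE; exact: xchooseP.
Qed.

End Menus.

Section Sample.
Variables (R : realType) (J T N : nat) (a : 'I_N.+1 -> menu J T).

(* a_1 x ... x a_N, with a given sequence a of menus, one per observation *)
Definition outcome :=
  {w : {ffun 'I_N.+1 -> history J T} | [forall i, w i \in val (a i)]}.

HB.instance Definition _ := SubFinite.on outcome.

Fact outcome_subproof :
  [forall i, [ffun i => xchoose (set0Pn _ (menu_neq0 (a i)))] i \in val (a i)].
Proof. by apply/forallP => i; rewrite ffunE; exact: xchooseP. Qed.

HB.instance Definition _ := isPointed.Build outcome
  (exist (fun w : {ffun 'I_N.+1 -> history J T} => [forall i, w i \in val (a i)])
    _ outcome_subproof).

Definition outcome_law := probability (discrete outcome) R.

(* P_i(y).  The i-th marginal is taken on the whole of [J]^T; it charges only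
   the menu a_i. *)
Definition marginal (P : outcome_law) (i : 'I_N.+1) (y : history J T) : R :=
  fine (pushforward P
    (fun w : discrete outcome => val w i : discrete (history J T)) [set y]).

(* The average of the P_i(y) over the n_a observations i with menu a, at the
   pair p = (a, y). *)
Definition cond_law (P : outcome_law) (p : menu J T * history J T) : R :=
  #|[pred i | a i == p.1]|%:R^-1 * \sum_(i | a i == p.1) marginal P i p.2.

Definition observables : {set menu J T * history J T} :=
  [set p | (p.1 \in codom a) && (p.2 \in val p.1)]%SET.

Definition is_ordering (o : 'I_#|observables| -> menu J T * history J T) :=
  injective o /\ codom o =i observables.

Variables (o : 'I_#|observables| -> menu J T * history J T).
Variables (L : nat) (leL : (L <= #|observables|)%N).

(* (b_l(P))_{l <= L}, for the first L pairs of the ordering o *)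
Definition data_vector (P : outcome_law) : 'cV[R]_L :=
  \col_l cond_law P (o (widen_ord leL l)).

End Sample.

Section Model.
Variables (R : realType) (J T : nat) (d : measure_display) (B : measurableType d).

Definition is_choice_kernel (s : B -> menu J T -> history J T -> R) : Prop :=
  [/\ measurable_fun [set: B * discrete (menu J T) * discrete (history J T)]
        (fun x => s x.1.1 x.1.2 x.2),
      forall (beta : B) (a : menu J T) (y : history J T), 0 <= s beta a y <= 1,
      forall (beta : B) (a : menu J T) (y : history J T),
        y \notin val a -> s beta a y = 0 &
      forall (beta : B) (a : menu J T), \sum_(y in val a) s beta a y = 1].

(* t_l(beta) = s(beta, a(l), y(l)) *)
Definition moment (s : B -> menu J T -> history J T -> R) (n : nat)
    (o : 'I_n -> menu J T * history J T) (l : 'I_n) (beta : B) : R :=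
  s beta (o l).1 (o l).2.

End Model.

Section Functions.
Variables (R : realType) (X : Type).

Definition lin_comb (I : finType) (f : I -> X -> R) (c : I -> R) : X -> R :=
  fun x => \sum_i c i * f i x.

Definition lin_span (I : finType) (f : I -> X -> R) : set (X -> R) :=
  range (lin_comb f).

(* Independence of a family; such a family is injective, so an independent
   family indexed by 'I_k in S is a k-element independent subset of S. *)
Definition lin_indep (I : finType) (f : I -> X -> R) : Prop :=
  forall c : I -> R, (forall x, lin_comb f c x = 0) -> forall i, c i = 0.

Definition max_indep_card (S : set (X -> R)) (m : nat) : Prop :=
  (exists f : 'I_m -> X -> R, range f `<=` S /\ lin_indep f) /\
  (forall (k : nat) (f : 'I_k -> X -> R),
     range f `<=` S -> lin_indep f -> (k <= m)%N).

(* The family 1, t_1, ..., t_n, with None indexing the constant 1. *)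
Definition with_one (n : nat) (t : 'I_n -> X -> R) (i : option 'I_n) : X -> R :=
  if i is Some l then t l else fun=> 1.

End Functions.

Section LinearProgram.
Variables (R : realType) (d : measure_display) (B : measurableType d).
Variables (n : nat) (t : 'I_n -> B -> R) (g : B -> R).
Implicit Types (b : 'cV[R]_n) (Q : probability B R) (u : 'cV[R]_n * R).

Definition primal_feasible b : set (probability B R) :=
  [set Q | forall l, (\int[Q]_beta (t l beta)%:E = (b l 0)%:E)%E].

Definition primal_value b : \bar R :=
  ereal_sup [set (\int[Q]_beta (g beta)%:E)%E | Q in primal_feasible b].

Definition primal_maximizer b Q : Prop :=
  primal_feasible b Q /\
  (forall Q', primal_feasible b Q' ->
     (\int[Q']_beta (g beta)%:E <= \int[Q]_beta (g beta)%:E)%E).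

(* Rows (t_l(x_k))_k for l <= n, then a last row of ones. *)
Definition support_matrix (x : 'I_(n + 1) -> B) : 'M[R]_(n + 1) :=
  col_mx (\matrix_(l < n, k < n + 1) t l (x k)) (const_mx 1).

Definition primal_nondegenerate b : Prop :=
  exists (Q : probability B R) (q : 'I_(n + 1) -> R) (x : 'I_(n + 1) -> B),
    [/\ primal_maximizer b Q,
        forall A, measurable A -> Q A = (\sum_k (q k)%:E * \d_(x k) A)%E,
        forall k, 0 < q k,
        \sum_k q k = 1 &
        \rank (support_matrix x) = (n + 1)%N].

(* u = (lambda, nu) *)
Definition dual_feasible u : Prop :=
  forall beta, g beta <= (u.1^T *m \col_l t l beta) 0 0 + u.2.

Definition dual_objective b u : R := (u.1^T *m b) 0 0 + u.2.

Definition dual_minimizer b u : Prop :=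
  dual_feasible u /\
  (forall u', dual_feasible u' -> dual_objective b u <= dual_objective b u').

End LinearProgram.

(* Neighborhoods in M are pulled back along the data map b : M -> R^n. *)
Definition is_neighborhood (R : realType) (M : Type) (n : nat)
    (b : M -> 'cV[R]_n) (P0 : M) (V : set M) : Prop :=
  exists v : set 'cV[R]_n, nbhs (b P0) v /\ (forall P, v (b P) -> V P).

(* Main.v *)
(* Let M be the support matrix of the given primal maximizer.  The pair (lambda,
   nu) with lambda^T t + nu = g at the atoms is dual feasible, since otherwise
   shifting mass from the atoms to a violating point would beat the maximizer.
   For b(P) near b(P^N) the weights M^-1 (b(P); 1) stay positive, so they define
   a feasible measure on the same atoms, whose objective equals the dual
   objective of that same (lambda, nu); weak duality and complementary slackness
   conclude. *)
Require Import Defs.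
From HB Require Import structures.
From mathcomp Require Import all_boot all_order all_algebra.
From mathcomp Require Import all_classical all_reals all_analysis.
From mathcomp Require Import measurable_realfun.

Set Implicit Arguments.
Unset Strict Implicit.
Unset Printing Implicit Defensive.

Import Order.TTheory GRing.Theory Num.Theory.
Import numFieldNormedType.Exports.

Local Open Scope classical_set_scope.
Local Open Scope ring_scope.

(** * Finitely supported measures and their integrals *)

Definition unit_mass_measure (R : realType) (d : measure_display)
    (B : measurableType d) (mu : {measure set B -> \bar R})
    (mu1 : mu setT = 1%E) : set B -> \bar R := mu.

HB.instance Definition _ (R : realType) (d : measure_display)
    (B : measurableType d) (mu : {measure set B -> \bar R})
    (mu1 : mu setT = 1%E) := Measure.on (unit_mass_measure mu1).

HB.instance Definition _ (R : realType) (d : measure_display)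
    (B : measurableType d) (mu : {measure set B -> \bar R})
    (mu1 : mu setT = 1%E) :=
  Measure_isProbability.Build d B R (unit_mass_measure mu1) mu1.

(** The finite combination of Dirac masses with weights [q]. Since [msum] takes a sequence indexed
    by all naturals, [insub] recovers the ordinal; the [mzero] branch is never reached below [m]. *)
Definition mixture (R : realType) (d : measure_display) (B : measurableType d)
    (m : nat) (q : 'I_m -> {nonneg R}) (x : 'I_m -> B) :
    {measure set B -> \bar R} :=
  msum (fun k => if insub k is Some i then mscale (q i) (dirac (x i))
                 else mzero : {measure set B -> \bar R}) m.

Lemma mixtureE (R : realType) (d : measure_display) (B : measurableType d)
    (m : nat) (q : 'I_m -> {nonneg R}) (x : 'I_m -> B) (A : set B) :
  mixture q x A = (\sum_k (q k)%:num%:E * \d_(x k) A)%E.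
Proof. by rewrite /mixture /= /msum; apply: eq_bigr => k _; rewrite valK. Qed.

Lemma ge0_integral_mixture (R : realType) (d : measure_display)
    (B : measurableType d) (m : nat) (q : 'I_m -> {nonneg R}) (x : 'I_m -> B)
    (f : B -> R) :
  measurable_fun [set: B] f -> (forall z, 0 <= f z) ->
  (\int[mixture q x]_z (f z)%:E = (\sum_k (q k)%:num * f (x k))%:E)%E.
Proof.
move=> mf f0.
have mf' : measurable_fun [set: B] (fun z => (f z)%:E) by exact/measurable_EFinP.
have f0' z : [set: B] z -> (0 <= (f z)%:E)%E by rewrite lee_fin.
rewrite /mixture ge0_integral_measure_sum// -sumEFin.
apply: eq_bigr => k _; rewrite valK ge0_integral_mscale// integral_dirac//.
by rewrite diracT mul1e.
Qed.

Lemma mixture_setT (R : realType) (d : measure_display) (B : measurableType d)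
    (m : nat) (q : 'I_m -> {nonneg R}) (x : 'I_m -> B) :
  mixture q x setT = (\sum_k (q k)%:num)%:E.
Proof.
by rewrite mixtureE -sumEFin; apply: eq_bigr => k _; rewrite diracT mule1.
Qed.

(** * Primal candidates and weak duality *)

Section LinearProgramDuality.
Variables (R : realType) (d : measure_display) (B : measurableType d).
Variables (n : nat) (t : 'I_n -> B -> R) (g : B -> R).
Hypotheses (t_meas : forall l, measurable_fun [set: B] (t l))
  (t_bnd : forall l z, 0 <= t l z <= 1).
Hypotheses (g_meas : measurable_fun [set: B] g) (g_bnd : forall z, 0 <= g z <= 1).

Let t_ge0 l z : 0 <= t l z. Proof. by case/andP: (t_bnd l z). Qed.
Let g_ge0 z : 0 <= g z. Proof. by case/andP: (g_bnd z). Qed.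

(** Supplies the explicit primal candidates. The number [m] of atoms is left free: [n + 1] atoms
    serve to attain the dual value, and one more serves to perturb a maximizer. *)
Lemma atomic_primal_feasible (m : nat) (q : 'I_m -> R) (x : 'I_m -> B)
    (b : 'cV[R]_n) :
  (forall k, 0 <= q k) -> \sum_k q k = 1 ->
  (forall l, \sum_k q k * t l (x k) = b l 0) ->
  exists2 Q : probability B R, primal_feasible t b Q &
    (\int[Q]_z (g z)%:E = (\sum_k q k * g (x k))%:E)%E.
Proof.
move=> q0 q1 qt.
pose q' k : {nonneg R} := NngNum (q0 k).
have q'1 : mixture q' x setT = 1%E by rewrite mixture_setT q1.
pose Q : probability B R := unit_mass_measure q'1.
exists Q => [l|]; rewrite (eq_measure_integral (mixture q' x))//.
  by rewrite ge0_integral_mixture//= qt.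
exact: ge0_integral_mixture.
Qed.

Lemma dual_objectiveE (u : 'cV[R]_n * R) (b : 'cV[R]_n) :
  dual_objective b u = \sum_l u.1 l 0 * b l 0 + u.2.
Proof. by rewrite /dual_objective mxE; under eq_bigr do rewrite mxE. Qed.

(** Integrate the dual constraint against [Q]: feasibility turns the integral of each [t l] into
    [b l 0], and the constant [u.2] survives because [Q] has mass one. Integrability comes from the
    bounds on [t] and [g]. *)
Lemma weak_duality (b : 'cV[R]_n) (u : 'cV[R]_n * R) (Q : probability B R) :
  primal_feasible t b Q -> dual_feasible t g u ->
  (\int[Q]_z (g z)%:E <= (dual_objective b u)%:E)%E.
Proof.
move=> Qb ug.
have bounded_int (f : B -> R) : measurable_fun [set: B] f ->
    (forall z, 0 <= f z <= 1) -> Q.-integrable setT (EFin \o f).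
  move=> mf f01; apply: measurable_bounded_integrable => //.
    by rewrite -ge0_fin_numE// fin_num_measure.
  exists 1; split => // M M1 z _ /=; have /andP[f0 f1] := f01 z.
  by rewrite ger0_norm// (le_trans f1)// ltW.
have tint l : Q.-integrable setT (fun z => ((u.1 l 0)%:E * (t l z)%:E)%E).
  exact/integrableZl/bounded_int.
have sint : Q.-integrable setT (fun z => (\sum_l (u.1 l 0)%:E * (t l z)%:E)%E).
  exact: integrable_sum.
have cint : Q.-integrable setT (fun z => (u.2)%:E).
  by apply: finite_measure_integrable_cst.
have -> : (dual_objective b u)%:E =
    (\int[Q]_z (\sum_l (u.1 l 0)%:E * (t l z)%:E + (u.2)%:E))%E.
  rewrite integralD// integral_sum// integral_cst//= probability_setT mule1.
  rewrite dual_objectiveE EFinD -sumEFin; congr (_ + _)%E.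
  apply: eq_bigr => l _; rewrite integralZl//; last exact/bounded_int.
  by rewrite EFinM Qb.
apply: le_integral => //; [exact: bounded_int|exact: integrableD|move=> z _].
(* The left side of the dual constraint at [z] is [dual_objective] evaluated at the moment vector of
   [z]. *)
have := ug z; rewrite -/(dual_objective _ _) dual_objectiveE => gz.
rewrite (le_trans (y := (\sum_l u.1 l 0 * t l z + u.2)%:E))//.
  by rewrite lee_fin (le_trans gz)// lerD2r; apply: ler_sum => l _; rewrite !mxE.
by rewrite EFinD -sumEFin.
Qed.

(** * Barycentric coordinates with respect to the support points *)

Section Support.
Variable x : 'I_(n + 1) -> B.

Lemma support_matrix_mulE (w : 'cV[R]_(n + 1)) (b : 'cV[R]_n) :
  support_matrix t x *m w = col_mx b (const_mx 1) ->
  (forall l, \sum_k w k 0 * t l (x k) = b l 0) /\ \sum_k w k 0 = 1.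
Proof.
rewrite /support_matrix mul_col_mx => /eq_col_mx[/matrixP tw /matrixP w1].
split=> [l|].
  by rewrite -tw mxE; apply: eq_bigr => k _; rewrite !mxE mulrC.
have := w1 0 0; rewrite !mxE => <-.
by apply: eq_bigr => k _; rewrite mxE mul1r.
Qed.

(** [dual_objective] is affine in the vector, and [w], of total weight one but arbitrary sign,
    writes [b] as an affine combination of the moment vectors of the [x k]. *)
Lemma dual_objective_support (w : 'cV[R]_(n + 1)) (b : 'cV[R]_n)
    (u : 'cV[R]_n * R) :
  support_matrix t x *m w = col_mx b (const_mx 1) ->
  dual_objective b u = \sum_k w k 0 * dual_objective (\col_l t l (x k)) u.
Proof.
case/support_matrix_mulE=> tw w1.
under [RHS]eq_bigr do rewrite dual_objectiveE mulrDr.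
rewrite big_split /= -mulr_suml w1 mul1r dual_objectiveE; congr (_ + _).
under [RHS]eq_bigr do rewrite mulr_sumr.
rewrite exchange_big /=; apply: eq_bigr => l _.
by rewrite -tw mulr_sumr; apply: eq_bigr => k _; rewrite mxE mulrCA.
Qed.

Hypothesis x_unit : support_matrix t x \in unitmx.

Definition barycentric (b : 'cV[R]_n) : 'cV[R]_(n + 1) :=
  invmx (support_matrix t x) *m col_mx b (const_mx 1).

Lemma barycentricP (b : 'cV[R]_n) :
  support_matrix t x *m barycentric b = col_mx b (const_mx 1).
Proof. by rewrite mulKVmx. Qed.

Lemma barycentric_uniq (w : 'cV[R]_(n + 1)) (b : 'cV[R]_n) :
  support_matrix t x *m w = col_mx b (const_mx 1) -> w = barycentric b.
Proof. by move=> wb; rewrite /barycentric -wb mulKmx. Qed.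

Lemma dual_interpolation_exists : exists u : 'cV[R]_n * R,
  forall k, dual_objective (\col_l t l (x k)) u = g (x k).
Proof.
(* The row [r] solves [r *m support_matrix t x = \row_k g (x k)]; as the last row of the matrix is
   constant one, the last entry of [r] is nu and the others form lambda. *)
pose r : 'rV[R]_(n + 1) := (\row_k g (x k)) *m invmx (support_matrix t x).
exists ((lsubmx r)^T, rsubmx r 0 0) => k.
have -> : g (x k) = (r *m support_matrix t x) 0 k by rewrite mulmxKV// mxE.
rewrite dual_objectiveE -[r in RHS]hsubmxK mul_row_col !mxE; congr (_ + _).
  by apply: eq_bigr => l _; rewrite !mxE.
by rewrite big_ord1 !mxE mulr1.
Qed.

(** Every vector is an affine combination of the moment vectors of the support, so the two
    objectives agree everywhere; the zero vector then identifies nu and the basis vectors identify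
    lambda. *)
Lemma dual_interpolation_uniq (u v : 'cV[R]_n * R) :
  (forall k, dual_objective (\col_l t l (x k)) u =
             dual_objective (\col_l t l (x k)) v) -> u = v.
Proof.
move=> uv; have {uv}uv (b : 'cV[R]_n) : dual_objective b u = dual_objective b v.
  rewrite !(dual_objective_support _ (barycentricP b)).
  by apply: eq_bigr => k _; rewrite uv.
have uv2 : u.2 = v.2.
  by have := uv 0; rewrite /dual_objective !mulmx0 mxE !add0r.
apply/injective_projections => //; apply/colP => l.
have := uv (delta_mx l 0); rewrite /dual_objective uv2 => /addIr.
by rewrite -!colE !mxE.
Qed.

Lemma near_barycentric_gt0 (b0 : 'cV[R]_n) :
  (forall k, 0 < barycentric b0 k 0) ->
  \forall b \near b0, forall k, 0 < barycentric b k 0.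
Proof.
move=> b0_gt0; apply: (filter_forall (nbhs_filter b0)) => k.
have cont : (fun b : 'cV[R]_n => barycentric b k 0) @ b0 --> barycentric b0 k 0.
  rewrite /barycentric mxE; under eq_fun do rewrite mxE.
  apply: (cvg_big (@add_continuous R) (nbhs_filter b0)) => i _.
  apply: cvgM; first exact: cvg_cst.
  rewrite mxE; under eq_fun do rewrite mxE.
  case: splitP => j _; last by rewrite mxE; exact: cvg_cst.
  exact: coord_continuous.
exact: cvgr_gt cont _ (b0_gt0 k).
Qed.

(* If [g beta] exceeded the interpolant at [beta], moving a small mass from the
   atoms to [beta] along the barycentric coordinates of [beta] would keep the
   moments and increase the objective. *)
Lemma maximal_interpolation_dual_feasible (b : 'cV[R]_n) (u : 'cV[R]_n * R) :
  (forall k, 0 < barycentric b k 0) ->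
  (forall Q, primal_feasible t b Q ->
    (\int[Q]_z (g z)%:E <= (\sum_k barycentric b k 0 * g (x k))%:E)%E) ->
  (forall k, dual_objective (\col_l t l (x k)) u = g (x k)) ->
  dual_feasible t g u.
Proof.
move=> q_gt0 q_max ug beta; rewrite -/(dual_objective _ _).
set q := barycentric b in q_gt0 q_max.
have [qt q1] := support_matrix_mulE (barycentricP b).
pose w := barycentric (\col_l t l beta).
have [wt w1] := support_matrix_mulE (barycentricP (\col_l t l beta)).
rewrite (dual_objective_support _ (barycentricP _)) -/w.
under eq_bigr do rewrite ug.
(* [S] dominates every ratio of [w k 0] to [q k 0], so [eps] keeps all the weights
   [q k 0 - eps * w k 0] nonnegative; the added 1 keeps the denominator positive. *)
pose S := \sum_k `|w k 0| / q k 0.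
have S_ge0 : 0 <= S.
  by apply: sumr_ge0 => k _; rewrite divr_ge0// ltW.
pose eps := (S + 1)^-1.
have S1_gt0 : 0 < S + 1 by rewrite ltr_wpDl.
have eps_gt0 : 0 < eps by rewrite invr_gt0.
have qw_ge0 k : 0 <= q k 0 - eps * w k 0.
  rewrite subr_ge0 mulrC ler_pdivrMr// (le_trans (ler_norm _))//.
  rewrite -ler_pdivrMl// mulrC (le_trans (y := S))//; last by rewrite lerDl.
  rewrite /S (bigD1 k)//= lerDl sumr_ge0// => i _.
  by rewrite divr_ge0// ltW.
(* Index 0 carries the new atom [beta] with weight [eps]; the lifted indices carry the old atoms. *)
pose x' (i : 'I_(n + 1).+1) := oapp x beta (unlift ord0 i).
pose q' (i : 'I_(n + 1).+1) :=
  oapp (fun k => q k 0 - eps * w k 0) eps (unlift ord0 i).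
(* One identity serves three times: the correction term vanishes for the constant 1 and for each
   [t l], and for [g] maximality makes it nonpositive. *)
have q'_sum (f : B -> R) : \sum_i q' i * f (x' i) =
    \sum_k q k 0 * f (x k) + eps * (f beta - \sum_k w k 0 * f (x k)).
  rewrite big_ord_recl /q' /x' unlift_none /=.
  under eq_bigr do rewrite liftK /= mulrBl -mulrA.
  by rewrite sumrB -mulr_sumr mulrBr addrCA.
have [||l|Q Qb Qg] := @atomic_primal_feasible _ q' x' b.
- by move=> i; rewrite /q'; case: unliftP => [j|] _ /=; rewrite ?qw_ge0// ltW.
- have := q'_sum (fun=> 1); under eq_bigr do rewrite mulr1; move=> ->.
  under eq_bigr do rewrite mulr1.
  under [in X in _ + X]eq_bigr do rewrite mulr1.
  by rewrite q1 w1 subrr mulr0 addr0.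
- by rewrite q'_sum qt wt mxE subrr mulr0 addr0.
by have := q_max Q Qb; rewrite Qg lee_fin q'_sum gerDl pmulr_rle0// subr_le0.
Qed.

(** The barycentric weights give a feasible measure attaining the weak duality bound. Their strict
    positivity forces every dual minimizer to be tight at every atom, hence to interpolate [g]
    there. *)
Lemma interpolation_optimal (b : 'cV[R]_n) (u : 'cV[R]_n * R) :
  (forall k, 0 < barycentric b k 0) ->
  (forall k, dual_objective (\col_l t l (x k)) u = g (x k)) ->
  dual_feasible t g u ->
  primal_value t g b = (dual_objective b u)%:E /\
  unique (dual_minimizer t g b) u.
Proof.
move=> q_gt0 ug u_feas; have qP := barycentricP b.
have [qt q1] := support_matrix_mulE qP.
split.
  apply/eqP; rewrite eq_le; apply/andP; split.
    by apply: ge_ereal_sup => _ [Q Qb <-]; exact: weak_duality.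
  have [||//|Q Qb Qg] := @atomic_primal_feasible _ (barycentric b ^~ 0) x b.
  - by move=> k; exact: ltW.
  - exact: q1.
  apply: ereal_sup_ubound; exists Q => //; rewrite Qg; congr EFin.
  by rewrite (dual_objective_support _ qP); apply: eq_bigr => k _; rewrite ug.
have slack v k : dual_feasible t g v -> barycentric b k 0 * g (x k) <=
    barycentric b k 0 * dual_objective (\col_l t l (x k)) v.
  by move=> v_feas; rewrite ler_pM2l//; exact: v_feas.
have u_min v : dual_feasible t g v -> dual_objective b u <= dual_objective b v.
  move=> v_feas; rewrite !(dual_objective_support _ qP).
  by apply: ler_sum => k _; rewrite ug slack.
split=> // v [v_feas v_min]; apply: dual_interpolation_uniq => k.
have uv : dual_objective b u = dual_objective b v.
  by apply/eqP; rewrite eq_le u_min// v_min.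
move: uv; rewrite !(dual_objective_support _ qP).
under eq_bigr do rewrite ug.
(* Equal objectives make the weighted slacks of [v] at the atoms, all nonnegative, sum to zero, so
   each one vanishes. *)
move/eqP; rewrite eq_le => /andP[_]; rewrite -subr_le0 -sumrB => le0.
have sl i : 0 <= barycentric b i 0 * dual_objective (\col_l t l (x i)) v
    - barycentric b i 0 * g (x i) by rewrite subr_ge0 slack.
have /eqP : \sum_i (barycentric b i 0 * dual_objective (\col_l t l (x i)) v
    - barycentric b i 0 * g (x i)) = 0.
  by apply/eqP; rewrite eq_le le0 sumr_ge0.
rewrite psumr_eq0// => /allP/(_ k); rewrite mem_index_enum => /(_ isT)/=.
rewrite subr_eq0 => /eqP/(mulfI (lt0r_neq0 (q_gt0 k))) ->.
exact: ug.
Qed.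

End Support.
End LinearProgramDuality.

(** * Application to the choice model *)

Lemma choice_kernel_measurable (R : realType) (J T : nat) (d : measure_display)
    (B : measurableType d) (s : B -> menu J T -> history J T -> R)
    (a : menu J T) (y : history J T) :
  is_choice_kernel s -> measurable_fun [set: B] (fun beta => s beta a y).
Proof.
case=> sm _ _ _.
exact: (measurable_fun_pair1 (a : discrete _)
  (measurable_fun_pair1 (y : discrete _) sm)).
Qed.

Theorem theorem2 (R : realType) (J T N : nat) (a : 'I_N.+1 -> menu J T)
    (d : measure_display) (B : measurableType d)
    (s : B -> menu J T -> history J T -> R) (s_kernel : is_choice_kernel s)
    (g : B -> R) (g_meas : measurable_fun [set: B] g)
    (g_bnd : forall beta, 0 <= g beta <= 1)
    (o : 'I_#|observables a| -> menu J T * history J T)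
    (o_ordering : is_ordering o)
    (L : nat) (leL : (L <= #|observables a|)%N)
    (L_max : max_indep_card (range (with_one (moment s o))) L.+1)
    (t : 'I_L -> B -> R)
    (t_def : t = fun l => moment s o (widen_ord leL l))
    (t_indep : lin_indep (with_one t))
    (b : outcome_law R a -> 'cV[R]_L)
    (b_def : b = data_vector o leL)
    (PN : outcome_law R a) :
  ~ lin_span (with_one t) g ->
  primal_nondegenerate t g (b PN) ->
  exists V : set (outcome_law R a),
    is_neighborhood b PN V /\
    exists (lambda : outcome_law R a -> 'cV[R]_L) (nu : outcome_law R a -> R),
      forall P, V P ->
        [/\ unique (dual_minimizer t g (b P)) (lambda P, nu P),
            (primal_value t g (b P) - primal_value t g (b PN)
               = (((lambda P)^T *m (b P - b PN)) 0 0)%:E)%E &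
            lambda P = lambda PN].
Proof.
move=> _ [Q [q [x [[Qb Qmax] QE q_gt0 q1 x_rank]]]].
have t_meas l : measurable_fun [set: B] (t l).
  by rewrite t_def; exact: choice_kernel_measurable.
have t_bnd l z : 0 <= t l z <= 1.
  by rewrite t_def; case: s_kernel => _ + _ _; apply.
have x_unit : support_matrix t x \in unitmx.
  by rewrite -row_free_unit /row_free x_rank.
have Q_int (f : B -> R) : measurable_fun [set: B] f ->
    (forall z, 0 <= f z <= 1) ->
    (\int[Q]_z (f z)%:E = (\sum_k q k * f (x k))%:E)%E.
  move=> mf f01.
  rewrite -(ge0_integral_mixture (fun k => NngNum (ltW (q_gt0 k))))//.
    by apply: eq_measure_integral => A mA _; rewrite mixtureE; exact: QE.
  by move=> z; case/andP: (f01 z).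
(* Feasibility of [Q] and total mass one form a linear system with invertible matrix, which
   determines the weights. *)
have qE : \col_k q k = barycentric t x (b PN).
  apply: barycentric_uniq => //; rewrite /support_matrix mul_col_mx.
  congr col_mx; apply/colP => l; rewrite !mxE.
    have := Qb l; rewrite Q_int// => -[<-].
    by apply: eq_bigr => k _; rewrite !mxE mulrC.
  by rewrite -[RHS]q1; apply: eq_bigr => k _; rewrite !mxE mul1r.
have bary_gt0 k : 0 < barycentric t x (b PN) k 0 by rewrite -qE mxE.
have [u ug] := dual_interpolation_exists g x_unit.
have u_feas : dual_feasible t g u.
  apply: (maximal_interpolation_dual_feasible t_meas t_bnd g_meas g_bnd x_unit
    bary_gt0) => // Q' /Qmax.
  by rewrite -qE Q_int//; under [in X in _ -> X]eq_bigr do rewrite mxE.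
(* The neighborhood is where the same atoms still carry strictly positive weights. *)
exists [set P | forall k, 0 < barycentric t x (b P) k 0]; split.
  exists [set c | forall k, 0 < barycentric t x c k 0]; split => //.
  exact: near_barycentric_gt0.
(* The interpolant [u] depends on the atoms and on [g] but not on [P], so constant functions serve
   as witnesses. *)
exists (fun=> u.1), (fun=> u.2) => P P_gt0.
have opt := interpolation_optimal t_meas t_bnd g_meas g_bnd x_unit _ ug u_feas.
have [-> u_uniq] := opt _ P_gt0; have [-> _] := opt _ bary_gt0.
split=> //; first by case: (u) u_uniq.
(* Both primal values are objectives of the same [u], so nu cancels in the difference. *)
rewrite -EFinB /dual_objective; congr EFin.
by rewrite mulmxBr !mxE opprD addrACA subrr addr0.
Qed.
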